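(* Let $d\in\mathbb{C}$ with $d\ne0,-1,-2,\dots$, and let $n,\nu\in\mathbb{N}_0$. Then $$\sum_{k=0}^{n}\frac{(-1)^k}{2^k}\,\frac{\binom{n+1}{k+1}}{\binom{k+d}{k+1}}\,\frac{\binom{k+d+1}{k+1}}{\binom{k+2}{k+1}}\binom{2k}{k}=\begin{cases}\dfrac{(2\nu+1)(d+1)}{2d}\left[1+\dfrac{2\nu}{3}\left(\dfrac{2d+1}{d+1}\right)\right]\dfrac{\left(\frac12\right)_\nu}{(2)_\nu}, & n=2\nu,\\[2ex] \dfrac{(\nu+1)(2d+1)}{3d}\,\dfrac{\left(\frac32\right)_\nu}{(2)_\nu}, & n=2\nu+1.\end{cases}$$
   Context: $\mathbb{N}_0=\{0,1,2,\dots\}$. The Pochhammer symbol is $(\alpha)_0=1$, $(\alpha)_m=\alpha(\alpha+1)\cdots(\alpha+m-1)$ for $m\ge1$. Binomial coefficients with non-integer upper entry are generalized binomial coefficients; explicitly, for $k\in\mathbb{N}_0$, $\binom{k+d}{k+1}=\frac{d\,(d+1)_k}{(2)_k}=\frac{(d)_{k+1}}{(k+1)!}$ and $\binom{k+d+1}{k+1}=\frac{(d+1)(d+2)_k}{(2)_k}=\frac{(d+1)_{k+1}}{(k+1)!}$. *)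

(* Defs.v *)
From mathcomp Require Import all_boot all_order all_algebra.
From mathcomp Require Export reals complex.

Set Implicit Arguments.
Unset Strict Implicit.
Unset Printing Implicit Defensive.

Import GRing.Theory.

Local Open Scope ring_scope.

Definition pochhammer (F : fieldType) (a : F) (m : nat) : F :=
  \prod_(i < m) (a + i%:R).

(* x (x - 1) ... (x - m + 1) / m!, for an arbitrary upper entry x; the
   factorial is nonzero only in characteristic 0. *)
Definition gbinom (F : fieldType) (x : F) (m : nat) : F :=
  (\prod_(i < m) (x - i%:R)) / (m`!)%:R.

Lemma gbinom_pochhammer (F : fieldType) (d : F) (k : nat) :
  gbinom (k%:R + d) k.+1 = pochhammer d k.+1 / (k.+1)`!%:R.
Proof.
rewrite /gbinom /pochhammer; congr (_ / _).
rewrite (reindex_inj rev_ord_inj) /=; apply: eq_bigr => i _.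
rewrite subSS natrB; last by rewrite -ltnS.
by rewrite opprB [k%:R + d]addrC [i%:R - _]addrC addrA addrK.
Qed.

(* Main.v *)
Require Import Defs.
From mathcomp Require Import all_boot all_order all_algebra.
From mathcomp Require Import ring.

(** The parameter [d] enters only through the quotient of the two generalized
    binomials, which telescopes to [(d + k + 1) / d]; as
    [(d + k + 1) / (k + 2) = 1 + (d - 1) / (k + 2)], the sum equals
    [(A n + (d - 1) * B n) / d], where, with [x k = (-1/2)^k C(2k, k)],
    - [A n = sum_k C(n+1, k+1) x k],
    - [B n = sum_k C(n+1, k+1) x k / (k+2)], that is,
      [(n+2) * B n = sum_k C(n+2, k+2) x k].

    The hockey-stick identity ([sum_bin_shift]) makes [A n] the partial sum up
    to [n] of the binomial transform [c m = sum_k C(m, k) x k], and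
    [(n+2) * B n] the partial sum of [A].  The transform [c m] is the
    coefficient of [X^m] in [(X - (1+X)^2/2)^m = (-1/2)^m (1+X^2)^m]; it
    vanishes for odd [m] and equals [(1/2)_j / j!] for [m = 2j]
    ([bin_transform_central]).  Both summations are then instances of
    [sum_(j <= nu) (a)_j / j! = (a+1)_nu / nu!]
    ([sum_pochhammer_fact]), which turns [1/2] into [3/2] and [3/2] into
    [5/2], and what remains is rational-function algebra. *)

Set Implicit Arguments.
Unset Strict Implicit.
Unset Printing Implicit Defensive.

Import GRing.Theory Num.Theory.

Local Open Scope ring_scope.

(** * Pochhammer symbols *)

Lemma pochhammer0 (F : fieldType) (a : F) : pochhammer a 0 = 1.
Proof. by rewrite /pochhammer big_ord0. Qed.

Lemma pochhammerS (F : fieldType) (a : F) m :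
  pochhammer a m.+1 = pochhammer a m * (a + m%:R).
Proof. by rewrite /pochhammer big_ord_recr. Qed.

Lemma pochhammer_shift (F : fieldType) (a : F) m :
  a * pochhammer (a + 1) m = pochhammer a m * (a + m%:R).
Proof.
rewrite -pochhammerS /pochhammer big_ord_recl addr0; congr (_ * _).
by apply: eq_bigr => i _; rewrite lift0 -natr1 -addrA [1 + _]addrC.
Qed.

Lemma pochhammer_neq0 (F : fieldType) (a : F) m :
  (forall i : nat, a <> - i%:R) -> pochhammer a m != 0.
Proof.
move=> ha; apply/prodf_neq0 => i _.
by rewrite addr_eq0; apply/eqP/ha.
Qed.

Lemma pochhammer2 (F : fieldType) m : pochhammer (2 : F) m = (m.+1)`!%:R.
Proof.
elim: m => [|m IHm]; first by rewrite pochhammer0.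
by rewrite pochhammerS IHm [in RHS]factS mulnC natrM -natrD.
Qed.

(** The two products [(d+1)...(d+k+1)] and [d...(d+k)] overlap in all but one
    factor each. *)
Lemma gbinom_ratio (F : fieldType) (d : F) k :
    (forall m : nat, d <> - m%:R) -> k.+1`!%:R != 0 :> F ->
  gbinom (k%:R + d + 1) k.+1 / gbinom (k%:R + d) k.+1 = (d + k.+1%:R) / d.
Proof.
move=> hd fact_neq0; rewrite -addrA !gbinom_pochhammer.
have poch_neq0 := pochhammer_neq0 k.+1 hd.
have d_neq0 : d != 0 by apply/eqP => d0; apply: (hd 0%N); rewrite d0 oppr0.
have poch_shift := pochhammer_shift d k.+1.
rewrite invf_div mulrA divfK //; apply/eqP.
by rewrite eqr_div // mulrC poch_shift mulrC.
Qed.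

Section CharZero.

Variable F : numFieldType.

Let natS_neq0 m : m.+1%:R != 0 :> F. Proof. by rewrite pnatr_eq0. Qed.

Let fact_neq0 m : m`!%:R != 0 :> F.
Proof. by rewrite pnatr_eq0 -lt0n fact_gt0. Qed.

(** Vandermonde's convolution with a second factor [(1)_(nu-j) / (nu-j)! = 1],
    hence the increment of [a] by [1]. *)
Lemma sum_pochhammer_fact (a : F) nu :
  \sum_(j < nu.+1) pochhammer a j / j`!%:R = pochhammer (a + 1) nu / nu`!%:R.
Proof.
elim: nu => [|nu IHnu]; first by rewrite big_ord1 !pochhammer0.
rewrite big_ord_recr /= {}IHnu !pochhammerS -pochhammer_shift factS natrM.
have nz1 := natS_neq0 nu; have nz2 := fact_neq0 nu.
rewrite -natr1 in nz1 *; field.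
by rewrite nz2 nz1.
Qed.

Lemma fact_double nu : (2 * nu)`!%:R = 4 ^+ nu * nu`!%:R * pochhammer (1 / 2 : F) nu.
Proof.
elim: nu => [|nu IHnu]; first by rewrite pochhammer0 !mulr1.
rewrite mulnS !factS !natrM IHnu pochhammerS exprS -!natr1 natrM.
by field.
Qed.

Lemma central_bin_pochhammer nu :
  'C(2 * nu, nu)%:R / 4 ^+ nu = pochhammer (1 / 2) nu / nu`!%:R :> F.
Proof.
have four_neq0 : 4 ^+ nu != 0 :> F by rewrite expf_neq0.
apply/eqP; rewrite eqr_div //; apply/eqP/(mulIf (fact_neq0 nu)).
have := bin_fact (leq_pmull nu (isT : (0 < 2)%N)).
rewrite mul2n -addnn addnK addnn -mul2n => /(congr1 (fun m => m%:R : F)).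
rewrite !natrM fact_double => bin_eq.
by rewrite -mulrA bin_eq; ring.
Qed.

(** * Binomial sums *)

(** The hockey-stick identity [C(n+r+1, k+r+1) = sum_(m <= n) C(m+r, k+r)],
    weighted by [x k] and summed over [k]. *)
Lemma sum_bin_shift (x : nat -> F) r n :
  \sum_(k < n.+1) 'C(n.+1 + r, k.+1 + r)%:R * x k =
  \sum_(m < n.+1) \sum_(k < m.+1) 'C(m + r, k + r)%:R * x k.
Proof.
elim: n => [|n IHn]; first by rewrite !big_ord1 !binn.
rewrite [RHS]big_ord_recr /= -{}IHn.
under eq_bigr do rewrite addSn [in X in 'C(_, X)]addSn binS natrD mulrDl.
rewrite big_split /=; congr (_ + _).
rewrite big_ord_recr /= [X in _ + X](_ : _ = 0) ?addr0.
  by apply: eq_bigr => k _; rewrite addSn.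
by rewrite bin_small ?mul0r // addSn ltnS leqnn.
Qed.

(** The Taylor coefficients of [(1 + 2 x)^(-1/2)]. *)
Definition central (k : nat) : F := (- 2^-1) ^+ k * 'C(2 * k, k)%:R.

Lemma coef_1DX_exp m i : ((1 + 'X : {poly F}) ^+ m)`_i = 'C(m, i)%:R.
Proof.
rewrite exprDn coef_sum.
under eq_bigr do rewrite expr1n mul1r coefMn coefXn.
have [le_im | lt_mi] := leqP i m.
  rewrite (bigD1 (Ordinal (le_im : i < m.+1)%N)) //= eqxx big1 ?addr0 // => j.
  by rewrite -val_eqE /= eq_sym => /negbTE ->; rewrite mul0rn.
rewrite bin_small // big1 // => j _.
by rewrite gtn_eqF ?mul0rn // (leq_trans (ltn_ord j)).
Qed.

(** Both sides are the coefficient of [X^n] in the [n]-th power of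
    [X - (1+X)^2/2 = -(1+X^2)/2]: expanding the left form, the term
    [C(n, k) X^(n-k) (-1/2)^k (1+X)^(2k)] contributes the central coefficient
    of [(1+X)^(2k)]. *)
Lemma bin_transform_coef n :
  \sum_(k < n.+1) 'C(n, k)%:R * central k =
  (- 2^-1) ^+ n * \sum_(i < n.+1) 'C(n, i)%:R * (n == (2 * i)%N)%:R.
Proof.
pose c : {poly F} := (- 2^-1)%:P.
have sq : 'X + c * (1 + 'X) ^+ 2 = c * (1 + 'X ^+ 2).
  have two_c : c * 2 = -1.
    by rewrite -[2]/(2%:R) -polyC_natr -polyCM mulNr mulVf ?polyCN.
  have -> : c * (1 + 'X) ^+ 2 = c * (1 + 'X ^+ 2) + c * 2 * 'X by ring.
  by rewrite two_c; ring.
have := congr1 (fun p : {poly F} => (p ^+ n)`_n) sq.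
rewrite /= exprDn exprMn -polyC_exp coefCM (exprDn 1 ('X ^+ 2)) !coef_sum => coef_eq.
transitivity (\sum_(i < n.+1) ('X ^+ (n - i) * (c * (1 + 'X) ^+ 2) ^+ i *+ 'C(n, i))`_n).
  apply: eq_bigr => k _.
  have le_kn : (k <= n)%N by rewrite -ltnS.
  rewrite coefMn coefXnM ltnNge leq_subr /= subKn // exprMn -polyC_exp coefCM.
  by rewrite -exprM coef_1DX_exp mulr_natl.
rewrite {}coef_eq; congr (_ * _); apply: eq_bigr => i _.
by rewrite expr1n mul1r coefMn -exprM coefXn mulr_natl.
Qed.

Lemma bin_transform_central n :
  \sum_(k < n.+1) 'C(n, k)%:R * central k =
  if odd n then 0 else pochhammer (1 / 2) n./2 / (n./2)`!%:R.
Proof.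
rewrite bin_transform_coef; case: ifPn => [odd_n | even_n].
  rewrite big1 ?mulr0 // => i _; case: eqP => [n_eq | _]; last by rewrite mulr0.
  by rewrite n_eq oddM in odd_n.
have n_eq : (2 * n./2 = n)%N by rewrite mul2n even_halfK.
have lt_half : (n./2 < n.+1)%N by rewrite ltnS -[leqRHS]n_eq leq_pmull.
rewrite (bigD1 (Ordinal lt_half)) //= n_eq eqxx mulr1 big1 ?addr0.
  rewrite -central_bin_pochhammer n_eq -{1}n_eq exprM sqrrN mulrC.
  by rewrite -[in RHS]exprVn; congr (_ * _ ^+ _); field.
move=> i; rewrite -val_eqE /= => i_neq.
by rewrite -[X in X == _]n_eq eqn_mul2l /= eq_sym (negbTE i_neq) mulr0.
Qed.

(** Since every second summand vanishes, a partial sum only sees [n./2]. *)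
Lemma sum_bin1_central n :
  \sum_(k < n.+1) 'C(n.+1, k.+1)%:R * central k =
  pochhammer (3 / 2) n./2 / (n./2)`!%:R.
Proof.
have -> : 3 / 2 = 1 / 2 + 1 :> F by field.
rewrite -sum_pochhammer_fact.
transitivity (\sum_(m < n.+1) \sum_(k < m.+1) 'C(m, k)%:R * central k).
  have := sum_bin_shift central 0 n.
  under eq_bigr do rewrite !addn0.
  by under [in RHS]eq_bigr do under eq_bigr do rewrite !addn0.
under eq_bigr do rewrite bin_transform_central.
elim: n => [|n IHn]; first by rewrite !big_ord1.
rewrite big_ord_recr /= {}IHn uphalf_half; case: (odd n) => /=.
  by rewrite add1n [RHS]big_ord_recr.
by rewrite add0n addr0.
Qed.

Lemma sum_bin2_central n :
  \sum_(k < n.+1) 'C(n.+2, k.+2)%:R * central k =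
  \sum_(m < n.+1) pochhammer (3 / 2) m./2 / (m./2)`!%:R.
Proof.
have := sum_bin_shift central 1 n.
under eq_bigr do rewrite !addn1.
move=> ->; apply: eq_bigr => m _; rewrite -sum_bin1_central.
by apply: eq_bigr => k _; rewrite !addn1.
Qed.

(** Each value of [m./2] is taken twice, at [2j] and at [2j+1]. *)
Lemma sum_half_pochhammer nu :
  \sum_(m < (2 * nu).+2) pochhammer (3 / 2) m./2 / (m./2)`!%:R =
  2 * (pochhammer (5 / 2) nu / nu`!%:R) :> F.
Proof.
have -> : 5 / 2 = 3 / 2 + 1 :> F by field.
rewrite -sum_pochhammer_fact mul2n; move: (3 / 2) => a.
elim: nu => [|nu IHnu].
  by rewrite !big_ord_recr !big_ord0 /= !add0r mulr_natl mulr2n.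
rewrite doubleS 2!big_ord_recr {}IHnu [in RHS]big_ord_recr /=.
by rewrite uphalf_double half_double; ring.
Qed.

(** * Closed forms *)

(** What the sum of the theorem becomes once the double binomial sums are
    reduced to single ones: the two terms are [A n / d] and
    [(d - 1) * B n / d]. *)
Definition central_form (d : F) n : F :=
  (pochhammer (3 / 2) n./2 / (n./2)`!%:R
   + (d - 1) / n.+2%:R
     * \sum_(m < n.+1) pochhammer (3 / 2) m./2 / (m./2)`!%:R) / d.

Lemma sum_central_split (d : F) n :
    (forall m : nat, d <> - m%:R) ->
  \sum_(0 <= k < n.+1)
      (-1) ^+ k / 2 ^+ k
      * ('C(n.+1, k.+1)%:R / gbinom (k%:R + d) k.+1)
      * (gbinom (k%:R + d + 1) k.+1 / 'C(k.+2, k.+1)%:R)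
      * 'C(2 * k, k)%:R =
  central_form d n.
Proof.
move=> hd.
have d_neq0 : d != 0 by apply/eqP => d0; apply: (hd 0%N); rewrite d0 oppr0.
rewrite /central_form -sum_bin1_central -sum_bin2_central big_mkord mulr_sumr -big_split /=.
rewrite mulr_suml; apply: eq_bigr => k _.
have ratio := gbinom_ratio hd (fact_neq0 k.+1).
(* Absorption: [C(n+2, k+2) / (n+2) = C(n+1, k+1) / (k+2)]. *)
have absorb : 'C(n.+2, k.+2)%:R = n.+2%:R * 'C(n.+1, k.+1)%:R / k.+2%:R :> F.
  by rewrite -natrM mul_bin_diag natrM mulrC mulKf.
rewrite absorb binSn /central -expr_div_n mulN1r.
rewrite [LHS](_ : _ = (- 2^-1) ^+ k * 'C(n.+1, k.+1)%:R * 'C(2 * k, k)%:R / k.+2%:R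
  * (gbinom (k%:R + d + 1) k.+1 / gbinom (k%:R + d) k.+1)); last by ring.
rewrite ratio.
have nz1 := natS_neq0 n.+1; have nz2 := natS_neq0 k.+1.
have k1_eq : k.+1%:R = k.+2%:R - 1 :> F by rewrite -[k.+2%:R]natr1 addrK.
rewrite k1_eq; move: {k1_eq} (n.+2%:R) (k.+2%:R) nz1 nz2 => n2 k2 nz1 nz2.
by field; rewrite d_neq0 nz1 nz2.
Qed.


Let pochhammer32 nu :
  pochhammer (3 / 2 : F) nu = (2 * nu%:R + 1) * pochhammer (1 / 2) nu.
Proof.
have shift := pochhammer_shift (1 / 2 : F) nu.
have half_eq : 1 / 2 + 1 = 3 / 2 :> F by field.
rewrite half_eq in shift.
transitivity (2 * (1 / 2 * pochhammer (3 / 2 : F) nu)); first by field.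
by rewrite shift; field.
Qed.

Let pochhammer52 nu :
  pochhammer (5 / 2 : F) nu = (2 * nu%:R + 3) / 3 * pochhammer (3 / 2) nu.
Proof.
have shift := pochhammer_shift (3 / 2 : F) nu.
have half_eq : 3 / 2 + 1 = 5 / 2 :> F by field.
rewrite half_eq in shift.
transitivity (2 / 3 * (3 / 2 * pochhammer (5 / 2 : F) nu)); first by field.
by rewrite shift; field.
Qed.

Lemma central_form_even (d : F) nu : d != 0 -> d + 1 != 0 ->
  central_form d (2 * nu) =
  (2 * nu%:R + 1) * (d + 1) / (2 * d)
  * (1 + 2 * nu%:R / 3 * ((2 * d + 1) / (d + 1)))
  * (pochhammer (1 / 2) nu / pochhammer 2 nu).
Proof.
move=> d_neq0 d1_neq0; have nu1_neq0 := natS_neq0 nu.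
(* The partial sum up to [2 nu] is the one up to [2 nu + 1] minus its last
   term. *)
have := sum_half_pochhammer nu; rewrite big_ord_recr /= => sum_odd.
rewrite /central_form (canRL (addrK _) sum_odd).
rewrite pochhammer2 factS natrM mul2n uphalf_double doubleK.
rewrite pochhammer52 pochhammer32 -mul2n.
have -> : (2 * nu).+2%:R = 2 * (nu%:R + 1) :> F by rewrite -!natr1 natrM; ring.
rewrite -natr1 in nu1_neq0 *.
by field; rewrite d_neq0 d1_neq0 fact_neq0 nu1_neq0.
Qed.

Lemma central_form_odd (d : F) nu : d != 0 ->
  central_form d (2 * nu + 1) =
  (nu%:R + 1) * (2 * d + 1) / (3 * d)
  * (pochhammer (3 / 2) nu / pochhammer 2 nu).
Proof.
move=> d_neq0; have nu1_neq0 := natS_neq0 nu.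
rewrite /central_form addn1 sum_half_pochhammer pochhammer52.
rewrite pochhammer2 factS natrM /= mul2n uphalf_double -mul2n.
have n_neq0 := natS_neq0 (2 * nu).+2; move: n_neq0.
have -> : (2 * nu).+3%:R = 2 * nu%:R + 3 :> F by rewrite -!natr1 natrM; ring.
move=> n_neq0; rewrite -natr1 in nu1_neq0 *.
by field; rewrite d_neq0 fact_neq0 nu1_neq0 n_neq0.
Qed.

End CharZero.

Theorem theorem4p2 (R : realType) (d : R[i])
    (hd : forall m : nat, d <> - m%:R) (n nu : nat) :
  let S : R[i] :=
    \sum_(0 <= k < n.+1)
      (-1) ^+ k / 2 ^+ k
      * ('C(n.+1, k.+1)%:R / gbinom (k%:R + d) k.+1)
      * (gbinom (k%:R + d + 1) k.+1 / 'C(k.+2, k.+1)%:R)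
      * 'C(2 * k, k)%:R in
  (n = (2 * nu)%N ->
     S = (2 * nu%:R + 1) * (d + 1) / (2 * d)
         * (1 + 2 * nu%:R / 3 * ((2 * d + 1) / (d + 1)))
         * (pochhammer (1 / 2) nu / pochhammer 2 nu))
  /\
  (n = (2 * nu + 1)%N ->
     S = (nu%:R + 1) * (2 * d + 1) / (3 * d)
         * (pochhammer (3 / 2) nu / pochhammer 2 nu)).
Proof.
have d_neq0 : d != 0 by apply/eqP => d0; apply: (hd 0%N); rewrite d0 oppr0.
have d1_neq0 : d + 1 != 0 by rewrite addr_eq0; apply/eqP/(hd 1%N).
move=> S; have S_eq : S = central_form d n by exact: sum_central_split.
rewrite S_eq; split=> ->; first exact: central_form_even.
exact: central_form_odd.
Qed.
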